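(* Let $(X,\phi)$ be a calibrated manifold and let $f,g\in C^\infty(X)$ be $\phi$-plurisubharmonic. (i) If $\psi\in C^\infty(\mathbb R)$ is convex and increasing, then $\psi\circ f$ is $\phi$-plurisubharmonic. (ii) The function $\log(e^f+e^g)$ is $\phi$-plurisubharmonic. (iii) The functions $h_n=\frac1n\log\left(e^{nf}+e^{ng}\right)$, $n\ge 1$, form a decreasing sequence of $\phi$-plurisubharmonic functions which approximates $\max\{f,g\}$; more precisely, $$h_n-\tfrac1n\log 2\ \le\ \max\{f,g\}\ \le\ h_n .$$
   Context: A calibrated manifold $(X,\phi)$ of degree $p\ge 1$ is a smooth riemannian manifold $X$ together with a closed smooth $p$-form $\phi$ such that $\phi(\xi)\le 1$ for every unit simple tangent $p$-vector $\xi$ on $X$. $G(\phi)$ denotes the set of unit simple tangent $p$-vectors $\xi$ with $\phi(\xi)=1$ ($\phi$-planes). For $f\in C^\infty(X)$, the $\phi$-Hessian of $f$ is the $p$-form $\mathcal H^\phi(f)(v_1,\dots,v_p)=\sum_{i=1}^p\phi(v_1,\dots,\nabla_{v_i}(\nabla f),\dots,v_p)$ (with $\nabla_{v_i}(\nabla f)$ in the $i$-th slot), $\nabla$ being the Levi-Civita connection. $f$ is $\phi$-plurisubharmonic if $\mathcal H^\phi(f)(\xi)\ge 0$ for all $\xi\in G(\phi)$. *)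

(* Defs.v *)
From HB Require Import structures.
From mathcomp Require Import all_boot all_order all_algebra.
From mathcomp Require Import all_classical all_reals all_analysis.
From mathcomp Require Import ring lra.

Set Implicit Arguments.
Unset Strict Implicit.
Unset Printing Implicit Defensive.

Import Order.TTheory GRing.Theory Num.Theory.
Import numFieldNormedType.Exports.

Local Open Scope classical_set_scope.
Local Open Scope ring_scope.

(* Smooth manifolds are given by an atlas, and geometric objects on them by    *)
(* their components in the charts of the atlas, subject to the usual           *)
(* transformation rules. A tangent vector at a point of a chart is a row       *)
(* vector v : 'rV[R]_d of components; the differential of a change of charts   *)
(* sends it to v *m 'J tau x. A p-tuple of tangent vectors is a matrix         *)
(* v : 'M[R]_(p, d), whose rows are the vectors of the tuple.                  *)

Section SmoothFunctions.
Context {R : realType}.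

Definition partial d (k : 'I_d) (h : 'rV[R]_d -> R) : 'rV[R]_d -> R :=
  fun x => 'D_(delta_mx 0 k) h x.

(* C^oo on the open set U: all iterated partial derivatives, of every order    *)
(* including 0, exist and are differentiable at the points of U.               *)
Definition smooth_on d (U : set 'rV[R]_d) (h : 'rV[R]_d -> R) : Prop :=
  forall (s : seq 'I_d) (x : 'rV[R]_d), U x ->
    differentiable (foldr (@partial d) h s) x.

Definition smooth_real (psi : R -> R) : Prop :=
  forall (k : nat) (x : R), derivable (derive1n k psi) x 1.

End SmoothFunctions.

Record smooth_manifold (R : realType) (d : nat) := SmoothManifold {
  mcarrier :> topologicalType;
  mhausdorff : hausdorff_space mcarrier;
  msecond_countable : @second_countable mcarrier;
  chart : Type;
  dom : chart -> set mcarrier;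
  coord : chart -> mcarrier -> 'rV[R]_d;
  (* inverse of coord i on coord i @` dom i, arbitrary elsewhere *)
  param : chart -> 'rV[R]_d -> mcarrier;
  dom_cover : forall x : mcarrier, exists i, dom i x;
  dom_open : forall i, open (dom i);
  img_open : forall i, open (coord i @` dom i);
  coordK : forall i x, dom i x -> param i (coord i x) = x;
  coord_cont : forall i x, dom i x -> {for x, continuous (coord i)};
  param_cont : forall i x, (coord i @` dom i) x ->
    {for x, continuous (param i)};
  transition_smooth : forall i j (k : 'I_d),
    smooth_on (coord i @` (dom i `&` dom j))
      (fun x => coord j (param i x) 0 k)
}.

Arguments chart {R d} s.
Arguments dom {R d s} _ _.
Arguments coord {R d s} _ _.
Arguments param {R d s} _ _.

Section Tensors.
Context {R : realType} {d : nat}.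
Implicit Types M : smooth_manifold R d.

Definition img M (i : chart M) : set 'rV[R]_d := coord i @` dom i.

Definition overlap M (i j : chart M) : set 'rV[R]_d :=
  coord i @` (dom i `&` dom j).

Definition transition M (i j : chart M) : 'rV[R]_d -> 'rV[R]_d :=
  coord j \o param i.

Definition smooth_fun M (f : M -> R) : Prop :=
  forall i : chart M, smooth_on (img i) (f \o param i).

Record riemannian_metric M := RiemannianMetric {
  metric :> chart M -> 'rV[R]_d -> 'M[R]_d;
  metric_smooth : forall i a b, smooth_on (img i) (fun x => metric i x a b);
  metric_sym : forall i x, img i x -> (metric i x)^T = metric i x;
  metric_pos : forall i x (v : 'rV[R]_d), img i x -> v != 0 ->
    0 < (v *m metric i x *m v^T) 0 0;
  metric_transition : forall i j x, overlap i j x ->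
    metric i x = 'J (transition i j) x *m metric j (transition i j x)
                   *m ('J (transition i j) x)^T
}.

Definition set_row p (k : 'I_p) (w : 'rV[R]_d) (v : 'M[R]_(p, d)) :
  'M[R]_(p, d) := \matrix_(l < p) (if l == k then w else row l v).

Definition multilinear p (F : 'M[R]_(p, d) -> R) : Prop :=
  forall (v : 'M[R]_(p, d)) (k : 'I_p) (a : R) (w1 w2 : 'rV[R]_d),
    F (set_row k (a *: w1 + w2) v) = a * F (set_row k w1 v) + F (set_row k w2 v).

Definition alternating p (F : 'M[R]_(p, d) -> R) : Prop :=
  forall (v : 'M[R]_(p, d)) (k l : 'I_p), k != l -> row k v = row l v -> F v = 0.

Record smooth_form M (p : nat) := SmoothForm {
  form :> chart M -> 'rV[R]_d -> 'M[R]_(p, d) -> R;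
  form_multilinear : forall i x, img i x -> multilinear (form i x);
  form_alternating : forall i x, img i x -> alternating (form i x);
  form_smooth : forall i v, smooth_on (img i) (fun x => form i x v);
  form_transition : forall i j x v, overlap i j x ->
    form i x v = form j (transition i j x) (v *m 'J (transition i j) x)
}.

(* d phi (v_0, .., v_p) for constant vector fields v_0, .., v_p in the chart:  *)
(* their Lie brackets vanish, so only the derivative terms remain.             *)
Definition exterior_derivative M p (phi : smooth_form M p) (i : chart M)
    (x : 'rV[R]_d) (v : 'M[R]_(p.+1, d)) : R :=
  \sum_(k < p.+1) (-1) ^+ k * 'D_(row k v) (fun y => phi i y (row' k v)) x.

Definition closed_form M p (phi : smooth_form M p) : Prop :=
  forall (i : chart M) x v, img i x -> exterior_derivative phi i x v = 0.

(* A simple p-vector is represented by the rows v_1, .., v_p of v, as          *)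
(* v_1 /\ .. /\ v_p. The square of its norm in the p-th exterior power is the  *)
(* Gram determinant det <v_k, v_l>.                                            *)
Definition unit_simple M (g : riemannian_metric M) p (i : chart M)
    (x : 'rV[R]_d) (v : 'M[R]_(p, d)) : Prop :=
  \det (v *m g i x *m v^T) = 1.

Definition calibration M (g : riemannian_metric M) p (phi : smooth_form M p) :
    Prop :=
  closed_form phi /\
  (forall (i : chart M) x v, img i x -> unit_simple g i x v -> phi i x v <= 1).

(* The set G(phi). *)
Definition phi_plane M (g : riemannian_metric M) p (phi : smooth_form M p)
    (i : chart M) (x : 'rV[R]_d) (v : 'M[R]_(p, d)) : Prop :=
  unit_simple g i x v /\ phi i x v = 1.

Definition gradient M (g : riemannian_metric M) (f : M -> R) (i : chart M)
    (x : 'rV[R]_d) : 'rV[R]_d :=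
  (\row_k partial k (f \o param i) x) *m invmx (g i x).

(* Gamma^c_{ab} *)
Definition christoffel M (g : riemannian_metric M) (i : chart M)
    (a b c : 'I_d) (x : 'rV[R]_d) : R :=
  2^-1 * \sum_l invmx (g i x) c l *
    (partial a (fun y => g i y b l) x + partial b (fun y => g i y a l) x
     - partial l (fun y => g i y a b) x).

(* nabla_v Y at x, for the Levi-Civita connection of g *)
Definition levi_civita M (g : riemannian_metric M) (i : chart M)
    (Y : 'rV[R]_d -> 'rV[R]_d) (v : 'rV[R]_d) (x : 'rV[R]_d) : 'rV[R]_d :=
  \row_c ('D_v (fun y => Y y 0 c) x +
          \sum_a \sum_b v 0 a * Y x 0 b * christoffel g i a b c x).

Definition phi_hessian M (g : riemannian_metric M) p (phi : smooth_form M p)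
    (f : M -> R) (i : chart M) (x : 'rV[R]_d) (v : 'M[R]_(p, d)) : R :=
  \sum_(k < p)
    phi i x (set_row k (levi_civita g i (gradient g f i) (row k v) x) v).

Definition phi_psh M (g : riemannian_metric M) p (phi : smooth_form M p)
    (f : M -> R) : Prop :=
  smooth_fun f /\
  forall (i : chart M) x v, img i x -> phi_plane g phi i x v ->
    0 <= phi_hessian g phi f i x v.

End Tensors.

(* The formulas above for the gradient and the Levi-Civita connection satisfy   *)
(* the characterizations: <grad f, v> = df(v), and the connection is           *)
(* torsion-free and compatible with the metric.                                *)
Section LeviCivita.
Context {R : realType} {d : nat} (M : smooth_manifold R d).
Context (g : riemannian_metric M) (i : chart M).

Lemma metric_unitmx x : img i x -> g i x \in unitmx.
Proof.
move=> ix; rewrite -row_free_unit -kermx_eq0; apply/eqP/row_matrixP => k.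
rewrite row0; apply/eqP/negPn/negP => k0.
have := metric_pos g ix k0.
by rewrite -row_mul mulmx_ker row0 mul0mx mxE ltxx.
Qed.

Lemma gradientE f x (v : 'rV[R]_d) : img i x ->
  (gradient g f i x *m g i x *m v^T) 0 0 =
  \sum_k v 0 k * partial k (f \o param i) x.
Proof.
move=> ix; rewrite /gradient -(mulmxA _ (invmx _)) mulVmx ?metric_unitmx//.
by rewrite mulmx1 mxE; apply: eq_bigr => k _; rewrite !mxE mulrC.
Qed.

Lemma metricC x (a b : 'I_d) : img i x -> g i x a b = g i x b a.
Proof. by move=> ix; rewrite -[in LHS](metric_sym g ix) mxE. Qed.

Lemma partial_metricC x (a b c : 'I_d) : img i x ->
  partial c (fun y => g i y a b) x = partial c (fun y => g i y b a) x.
Proof.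
move=> ix; apply: near_eq_derive.
have : nbhs x (img i) by apply: open_nbhs_nbhs; split => //; exact: img_open.
by apply: filterS => y iy; rewrite metricC.
Qed.

Lemma christoffelC x (a b c : 'I_d) : img i x ->
  christoffel g i a b c x = christoffel g i b a c x.
Proof.
move=> ix; rewrite /christoffel; congr (_ * _); apply: eq_bigr => l _.
by rewrite (partial_metricC a b) // [X in _ * (X - _)]addrC.
Qed.

Lemma christoffel_lower x (a b c : 'I_d) : img i x ->
  \sum_l christoffel g i c a l x * g i x l b =
  2^-1 * (partial c (fun y => g i y a b) x + partial a (fun y => g i y c b) x
          - partial b (fun y => g i y c a) x).
Proof.
move=> ix; rewrite /christoffel.
under eq_bigr do rewrite -mulrA mulr_suml.
rewrite -mulr_sumr exchange_big /=; congr (_ * _).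
have Wg m : \sum_l invmx (g i x) l m * g i x l b = (m == b)%:R.
  have := congr1 (fun A : 'M[R]_d => A b m) (mulmxV (metric_unitmx ix)).
  rewrite !mxE eq_sym => <-; apply: eq_bigr => l _.
  by rewrite mulrC metricC.
rewrite (bigD1 b)//= [X in _ + X]big1 ?addr0 => [|m mb].
  by under eq_bigr do rewrite mulrAC; rewrite -mulr_suml Wg eqxx mul1r.
by under eq_bigr do rewrite mulrAC; rewrite -mulr_suml Wg (negbTE mb) mul0r.
Qed.

Lemma christoffel_metric x (a b c : 'I_d) : img i x ->
  partial c (fun y => g i y a b) x =
  \sum_l christoffel g i c a l x * g i x l b +
  \sum_l christoffel g i c b l x * g i x a l.
Proof.
move=> ix.
have -> : \sum_l christoffel g i c b l x * g i x a l =
          \sum_l christoffel g i c b l x * g i x l a.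
  by apply: eq_bigr => l _; rewrite (metricC a).
rewrite !christoffel_lower// (partial_metricC b a)//; set A := partial c _ x.
by field.
Qed.

End LeviCivita.

(* Main.v *)
Require Import Defs.
From mathcomp Require Import all_boot all_order all_algebra.
From mathcomp Require Import all_classical all_reals all_analysis.
From mathcomp Require Import ring lra.
Import Order.TTheory GRing.Theory Num.Theory.
Import numFieldNormedType.Exports.

(** Let H denote the phi-Hessian. It is linear in the function, and the second
    derivatives of a composite psi o w bring in one further term:

      H(psi o w)(v) = psi'(w) H(w)(v)
                      + psi''(w) sum_k dw(v_k) phi(v_1, .., grad w, .., v_p),

    grad w standing in the k-th slot (phi_hessian_add_comp). On a phi-plane v
    the last sum is nonnegative for every w, plurisubharmonic or not
    (sum_slot_ge0). Indeed phi is at most 1 on unit simple vectors and equals 1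
    at v, so v is a maximum; hence phi vanishes if one of the v_k is replaced
    with a vector normal to the plane (first_cousin), and replacing v_k with
    grad w gives the coefficient of v_k in the tangential projection of grad w.
    Since dw(v_k) = <grad w, v_k>, the sum is the squared length of that
    projection.

    A smooth convex increasing psi has psi', psi'' >= 0, whence (i). For (ii)
    and (iii), write

      (1/n) log (e^(n f) + e^(n g)) = f + s(g - f),
      s(t) = (1/n) log (1 + e^(n t)),

    where 0 <= s' <= 1 and s'' >= 0. The Hessian of this function is

      (1 - s') H(f) + s' H(g) + s'' (a nonnegative term),

    again nonnegative on phi-planes (phi_psh_interpolate); (ii) is the case
    n = 1. The bounds and the monotonicity in n follow from
    h_n = max(f, g) + s(-|f - g|) (log_sum_exp_max). *)

Set Implicit Arguments.
Unset Strict Implicit.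
Unset Printing Implicit Defensive.
Local Open Scope classical_set_scope.
Local Open Scope ring_scope.

(** * The first cousin principle *)

Section Slots.
Context {R : realType} {d p : nat}.
Implicit Types (v : 'M[R]_(p, d)) (w : 'rV[R]_d) (F : 'M[R]_(p, d) -> R).

Lemma row_set_row k l w v :
  row l (set_row k w v) = if l == k then w else row l v.
Proof. by apply/rowP => j; rewrite mxE mxE; case: eqP => // _; rewrite mxE. Qed.

Lemma set_row_id k v : set_row k (row k v) v = v.
Proof.
by apply/row_matrixP => l; rewrite row_set_row; case: eqP => // ->.
Qed.

Lemma multilinearD F k w1 w2 v : multilinear F ->
  F (set_row k (w1 + w2) v) = F (set_row k w1 v) + F (set_row k w2 v).
Proof. by move=> lF; rewrite -[w1 in LHS]scale1r lF mul1r. Qed.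

Lemma multilinear0 F k v : multilinear F -> F (set_row k 0 v) = 0.
Proof.
move=> lF; have := multilinearD k 0 0 v lF; rewrite addr0 => /eqP.
by rewrite -subr_eq0 opprD addNKr oppr_eq0 => /eqP.
Qed.

Lemma multilinearZ F k a w v : multilinear F ->
  F (set_row k (a *: w) v) = a * F (set_row k w v).
Proof.
by move=> lF; rewrite -[a *: w]addr0 lF multilinear0// addr0.
Qed.

Lemma multilinear_sum F k n (c : 'I_n -> R) (w : 'I_n -> 'rV[R]_d) v :
  multilinear F -> F (set_row k (\sum_i c i *: w i) v) =
                   \sum_i c i * F (set_row k (w i) v).
Proof.
move=> lF; apply: (big_rec2 (fun x y => F (set_row k x v) = y)).
  exact: multilinear0.
by move=> i y1 y2 _ IH; rewrite lF IH.
Qed.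

End Slots.

Section FirstCousin.
Context {R : realType} {d p : nat} (G : 'M[R]_d).
Implicit Types (v : 'M[R]_(p, d)) (w : 'rV[R]_d) (F : 'M[R]_(p, d) -> R).

Definition gram v : 'M[R]_p := v *m G *m v^T.

Lemma gramE v l m : gram v l m = (row l v *m G *m (row m v)^T) 0 0.
Proof.
rewrite /gram [LHS]mxE [RHS]mxE; apply: eq_bigr => j _.
rewrite !mxE; congr (_ * _); apply: eq_bigr => n _.
by rewrite !mxE.
Qed.

Lemma det_gram_scale k a v :
  \det (gram (set_row k (a *: row k v) v)) = a ^+ 2 * \det (gram v).
Proof.
pose D : 'M[R]_p := diag_mx (\row_l if l == k then a else 1).
have -> : set_row k (a *: row k v) v = D *m v.
  apply/matrixP => l j; rewrite mul_diag_mx !mxE.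
  by case: eqP => [->|_]; rewrite !mxE ?mul1r.
have detD : \det D = a.
  rewrite det_diag (bigD1 k)//= big1 ?mulr1 ?mxE ?eqxx// => l /negbTE lk.
  by rewrite mxE lk.
have -> : gram (D *m v) = D *m gram v *m D^T by rewrite /gram trmx_mul !mulmxA.
by rewrite !det_mulmx det_tr detD mulrAC -expr2.
Qed.

Hypothesis symG : G^T = G.

Lemma formC (w1 w2 : 'rV[R]_d) :
  (w1 *m G *m w2^T) 0 0 = (w2 *m G *m w1^T) 0 0.
Proof.
have -> : w1 *m G *m w2^T = (w2 *m G *m w1^T)^T.
  by rewrite !trmx_mul trmxK symG mulmxA.
by rewrite mxE.
Qed.

(** Since w is orthogonal to every row of v, adding it to row k changes a
    single entry of the Gram matrix, the diagonal one, and only by |w|^2. Hence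
    det (gram (v_1, .., v_k + t w, .., v_p)) is 1 + C t^2, without a linear
    term; this is what makes the first cousin principle work. *)
Lemma det_gram_normal k w v : v *m G *m w^T = 0 ->
  \det (gram (set_row k (row k v + w) v)) =
  \det (gram v) +
    (w *m G *m w^T) 0 0 * \det (set_row k (delta_mx 0 k) (gram v)).
Proof.
move=> vw0.
have vw l : (row l v *m G *m w^T) 0 0 = 0 by rewrite -!row_mul vw0 !mxE.
have wv l : (w *m G *m (row l v)^T) 0 0 = 0 by rewrite formC.
have entryD (A B : 'M[R]_1) : (A + B) 0 0 = A 0 0 + B 0 0 by rewrite mxE.
have nl (l : 'I_p.-1) : (lift k l == k) = false.
  by rewrite eq_sym (negbTE (neq_lift _ _)).
pose u := set_row k (row k v + w) v; rewrite -/u.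
have rowu l : row l u = if l == k then row k v + w else row l v.
  exact: row_set_row.
have u_k m : gram u k m = gram v k m + (w *m G *m w^T) 0 0 * (m == k)%:R.
  rewrite !gramE !rowu eqxx; have [->|_] := eqVneq m k.
    rewrite [in LHS]linearD/= !(mulmxDl, mulmxDr) !entryD mulr1.
    by rewrite vw wv addr0 add0r.
  by rewrite !mulmxDl entryD wv mulr0.
rewrite -[\det (gram v)]mul1r; apply: (@determinant_multilinear _ _ _ _ _ k).
- apply/rowP => m; rewrite [LHS]mxE [RHS]mxE u_k; congr (_ + _).
    by rewrite [RHS]mxE mul1r [RHS]mxE.
  by rewrite [RHS]mxE row_set_row eqxx; congr (_ * _); rewrite mxE eqxx.
- apply/matrixP => l m; rewrite [LHS]mxE [RHS]mxE !gramE !rowu.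
  rewrite nl; have [->|//] := eqVneq m k.
  by rewrite [in RHS]linearD/= mulmxDr entryD vw addr0.
- apply/matrixP => l m; rewrite [LHS]mxE [LHS]mxE [RHS]mxE.
  rewrite nl [LHS]mxE !gramE !rowu nl.
  have [->|//] := eqVneq m k.
  by rewrite [in RHS]linearD/= mulmxDr entryD vw addr0.
Qed.

(** Rescaling one row normalizes a tuple of positive Gram determinant, so the
    bound on unit tuples extends by homogeneity. The index k only witnesses
    that there is a row to rescale. *)
Lemma comass_le F v : multilinear F ->
  (forall u, \det (gram u) = 1 -> F u <= 1) ->
  forall k : 'I_p, 0 < \det (gram v) -> F v <= Num.sqrt (\det (gram v)).
Proof.
move=> lF F1 k gv; set q := Num.sqrt _.
have q0 : 0 < q by rewrite sqrtr_gt0.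
have := F1 (set_row k (q^-1 *: row k v) v).
rewrite multilinearZ// set_row_id det_gram_scale exprVn (sqr_sqrtr (ltW gv)).
by rewrite mulVf ?gt_eqF// ler_pdivrMl// mulr1; apply.
Qed.

(** The first cousin principle: a form of comass 1 that attains its maximum at
    v vanishes on the tuples obtained from v by replacing one vector with a
    vector normal to v. With a := F (set_row k w v), the comass bound at
    v_k + t w reads 1 + t a <= sqrt (1 + C t^2) for small t; as the right-hand
    side has no linear term in t, a must be 0. *)
Lemma first_cousin F v k w : multilinear F ->
  (forall u, \det (gram u) = 1 -> F u <= 1) ->
  \det (gram v) = 1 -> F v = 1 -> v *m G *m w^T = 0 -> F (set_row k w v) = 0.
Proof.
move=> lF F1 gv Fv vw; apply/eqP/negPn/negP; set a := F _ => a0.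
set C := (w *m G *m w^T) 0 0 * \det (set_row k (delta_mx 0 k) (gram v)).
(* At t = s a, squaring the bound gives 2 <= s C, while s is small enough for
   s C < 1 and for the Gram determinant at t to be positive. *)
pose s := (1 + `|C| * (1 + a ^+ 2))^-1.
have a2 : 0 < a ^+ 2 by rewrite exprn_even_gt0.
have D0 : 0 < 1 + `|C| * (1 + a ^+ 2) by have := normr_ge0 C; nra.
have s0 : 0 < s by rewrite invr_gt0.
have sE : s * (1 + `|C| * (1 + a ^+ 2)) = 1 by rewrite mulVf ?gt_eqF.
have sC : s * `|C| < 1 by have := normr_ge0 C; nra.
have s1 : s <= 1 by have := normr_ge0 C; nra.
have saC : s * (a ^+ 2 * `|C|) < 1 by have := normr_ge0 C; nra.
pose u := set_row k (row k v + (s * a) *: w) v.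
have gu : \det (gram u) = 1 + s ^+ 2 * a ^+ 2 * C.
  rewrite det_gram_normal ?gv; last by rewrite linearZ/= -scalemxAr vw scaler0.
  rewrite /C mulrA; congr (_ + _ * _).
  by rewrite linearZ/= -scalemxAr -!scalemxAl scalerA [LHS]mxE -expr2 exprMn.
have Fu : F u = 1 + s * a ^+ 2.
  by rewrite /u multilinearD// multilinearZ// set_row_id Fv -/a; ring.
have absC : - `|C| <= C <= `|C| by rewrite -ler_norml.
have gu0 : 0 < \det (gram u).
  rewrite gu; have : s ^+ 2 * a ^+ 2 * `|C| < 1.
    have -> : s ^+ 2 * a ^+ 2 * `|C| = s * (s * (a ^+ 2 * `|C|)) by ring.
    have := normr_ge0 C; nra.
  have : 0 < s ^+ 2 * a ^+ 2 by rewrite mulr_gt0// exprn_gt0.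
  nra.
have := comass_le lF F1 k gu0; rewrite Fu => le_sqrt.
have : (1 + s * a ^+ 2) ^+ 2 <= \det (gram u).
  rewrite -(sqr_sqrtr (ltW gu0)) ler_sqr ?nnegrE ?sqrtr_ge0//.
  by nra.
rewrite gu => {}le_sqrt.
have : 2 * (s * a ^+ 2) <= (s * C) * (s * a ^+ 2) by nra.
rewrite (ler_pM2r (mulr_gt0 s0 a2)); apply/negP; rewrite -ltNge.
rewrite (le_lt_trans _ (lt_trans sC _)) ?ltr1n// ler_pM2l//.
by case/andP: absC.
Qed.

(** Split w into its part c v tangent to the plane and its normal part. The
    normal part contributes nothing by the first cousin principle, and the
    component of c v along v_l with l != k contributes nothing because F
    alternates. *)
Lemma slot_projection F v k w : multilinear F -> Defs.alternating F ->
  (forall u, \det (gram u) = 1 -> F u <= 1) ->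
  \det (gram v) = 1 -> F v = 1 ->
  F (set_row k w v) = (w *m G *m v^T *m invmx (gram v)) 0 k.
Proof.
move=> lF aF F1 gv Fv; set c := w *m G *m v^T *m invmx (gram v).
have gramU : gram v \in unitmx by rewrite unitmxE gv unitr1.
have symgram : (gram v)^T = gram v by rewrite /gram !trmx_mul trmxK symG mulmxA.
have vn : v *m G *m (w - c *m v)^T = 0.
  rewrite linearB/= mulmxBr trmx_mul mulmxA -/(gram v) /c trmx_mul trmx_inv.
  by rewrite symgram mulKVmx// !trmx_mul trmxK symG mulmxA subrr.
rewrite -[w in LHS](subrK (c *m v)) multilinearD// (first_cousin _ lF)// add0r.
rewrite mulmx_sum_row multilinear_sum// (bigD1 k)//= set_row_id Fv mulr1.
rewrite big1 ?addr0// => l lk; rewrite (aF _ k l) ?mulr0// 1?eq_sym//.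
by rewrite !row_set_row eqxx (negbTE lk).
Qed.

(** The sum is |pi w|^2, where pi w is the orthogonal projection of w to the
    plane spanned by v. *)
Lemma sum_slot_ge0 F v w : multilinear F -> Defs.alternating F ->
  (forall u, \det (gram u) = 1 -> F u <= 1) ->
  (forall x : 'rV[R]_d, 0 <= (x *m G *m x^T) 0 0) ->
  \det (gram v) = 1 -> F v = 1 ->
  0 <= \sum_k (w *m G *m (row k v)^T) 0 0 * F (set_row k w v).
Proof.
move=> lF aF F1 G0 gv Fv; set c := w *m G *m v^T *m invmx (gram v).
have gramU : gram v \in unitmx by rewrite unitmxE gv unitr1.
have cgram : c *m gram v = w *m G *m v^T by rewrite mulmxKV.
suff -> : \sum_k (w *m G *m (row k v)^T) 0 0 * F (set_row k w v) =
    (c *m v *m G *m (c *m v)^T) 0 0 by [].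
have -> : c *m v *m G *m (c *m v)^T = c *m gram v *m c^T.
  by rewrite trmx_mul /gram !mulmxA.
rewrite cgram mxE; apply: eq_bigr => k _; rewrite slot_projection//.
rewrite [c^T k 0]mxE; congr (_ * _).
rewrite [LHS]mxE [RHS]mxE; apply: eq_bigr => j _.
by congr (_ * _); rewrite !mxE.
Qed.

End FirstCousin.

(** * Differentiable and smooth functions *)

Section Differentiability.
Context {R : realType} {V : normedModType R}.
Implicit Types (f g w : V -> R) (x v : V) (psi : R -> R).

(** The differential of f serves as that of g, being a first order expansion
    of it near x. *)
Lemma near_eq_differentiable f g x :
  {near x, f =1 g} -> differentiable f x -> differentiable g x.
Proof.
move=> fg df; apply/diff_locallyP.
have dfc : continuous ('d f x) by exact: diff_continuous.
have fx : f x = g x by exact: (nbhs_singleton fg).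
have gE : g \o shift x = cst (g x) + 'd f x +o_ 0 id.
  have /eqaddoP fo := diff_locally df.
  have fgs : \forall y \near (0 : V), (f \o shift x) y = (g \o shift x) y.
    by move: fg; rewrite (near_shift 0) subr0.
  apply/eqaddoP => e e0; apply: filterS2 fgs (fo e e0) => y.
  by rewrite /cst/= !fctE/= => <-; rewrite fx.
by rewrite (diff_unique dfc gE).
Qed.

Lemma differentiable_comp1 psi w x : derivable psi (w x) 1 ->
  differentiable w x -> differentiable (psi \o w) x.
Proof. by move=> /derivable1_diffP dpsi dw; exact: differentiable_comp. Qed.

Lemma derive_comp1 psi w x v : derivable psi (w x) 1 ->
  differentiable w x -> 'D_v (psi \o w) x = psi^`()%classic (w x) * 'D_v w x.
Proof.
move=> dpsi dw; have /derivable1_diffP dpsi' := dpsi.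
rewrite !deriveE//; last exact: differentiable_comp.
by rewrite diff_comp// /= deriv1E// [LHS]mulrC.
Qed.

Lemma differentiable_bigsum (I : Type) (r : seq I) (F : I -> V -> R) x :
  (forall i, differentiable (F i) x) ->
  differentiable (fun y => \sum_(i <- r) F i y) x.
Proof.
move=> dF; elim: r => [|i r IH].
  by under eq_fun do rewrite big_nil; exact: differentiable_cst.
by under eq_fun do rewrite big_cons; exact: differentiableD.
Qed.

Lemma differentiable_bigprod (I : Type) (r : seq I) (F : I -> V -> R) x :
  (forall i, differentiable (F i) x) ->
  differentiable (fun y => \prod_(i <- r) F i y) x.
Proof.
move=> dF; elim: r => [|i r IH].
  by under eq_fun do rewrite big_nil; exact: differentiable_cst.
by under eq_fun do rewrite big_cons; exact: differentiableM.
Qed.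

Lemma differentiable_det n (A : V -> 'M[R]_n) x :
  (forall i j, differentiable (fun y => A y i j) x) ->
  differentiable (fun y => \det (A y)) x.
Proof.
move=> dA; apply: differentiable_bigsum => s.
apply: differentiableM; first exact: differentiable_cst.
by apply: differentiable_bigprod => i.
Qed.

(** By Cramer's rule, the entries of the inverse are rational functions of those
    of A. *)
Lemma differentiable_invmx n (A : V -> 'M[R]_n) x :
  (\forall y \near x, A y \in unitmx) ->
  (forall i j, differentiable (fun y => A y i j) x) ->
  forall i j, differentiable (fun y => invmx (A y) i j) x.
Proof.
move=> uA dA i j.
apply: (@near_eq_differentiable
  (fun y => (\det (A y))^-1 *
    ((-1) ^+ (j + i) * \det (row' j (col' i (A y)))))).
  near=> y; have Uy : A y \in unitmx by near: y.
  by rewrite /invmx Uy !mxE.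
apply: differentiableM.
  apply: differentiableV; first exact: differentiable_det.
  by have := nbhs_singleton uA; rewrite unitmxE unitfE.
apply: differentiableM; first exact: differentiable_cst.
apply: differentiable_det => k l.
by under eq_fun do rewrite !mxE.
Unshelve. all: by end_near. Qed.

End Differentiability.

Section SmoothClosure.
Context {R : realType} {d : nat}.
Implicit Types (U : set 'rV[R]_d) (f h w : 'rV[R]_d -> R) (psi : R -> R).

Lemma derive_partial f x (v : 'rV[R]_d) : differentiable f x ->
  'D_v f x = \sum_k v 0 k * partial k f x.
Proof.
move=> df; rewrite deriveE// [v in LHS]row_sum_delta linear_sum/=.
by apply: eq_bigr => k _; rewrite linearZ/= /partial deriveE.
Qed.

(** A grading of smooth_on by the order of differentiation. The Leibniz and
    chain rules express a partial derivative of a product or of a composite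
    through functions that are smooth to one order less, so closure properties
    go by induction on n. *)
Fixpoint smooth_upto n U h : Prop :=
  (forall x, U x -> differentiable h x) /\
  if n is n'.+1 then forall k, smooth_upto n' U (partial k h) else True.

Lemma smooth_onP U h : smooth_on U h <-> forall n, smooth_upto n U h.
Proof.
split=> [sh n|sh s].
  elim: n h sh => [|n IH] h sh; (split; first exact: (sh [::])) => // k.
  by apply: IH => s x Ux; have := sh (rcons s k) x Ux; rewrite foldr_rcons.
elim/last_ind: s h sh => [|s k IH] h sh x Ux.
  by have [dh _] := sh 0%N; exact: dh.
by rewrite foldr_rcons; apply: IH Ux => n; have [_ sph] := sh n.+1; exact: sph.
Qed.

Lemma smooth_upto_diff n U h : smooth_upto n U h ->
  forall x, U x -> differentiable h x.
Proof. by case: n => [|n] []. Qed.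

Lemma smooth_uptoW n U h : smooth_upto n.+1 U h -> smooth_upto n U h.
Proof.
elim: n h => [|n IH] h [dh sh]; split => // k.
by apply: IH; exact: sh.
Qed.

Lemma near_open U (P : 'rV[R]_d -> Prop) x : open U -> U x ->
  (forall y, U y -> P y) -> \forall y \near x, P y.
Proof. by move=> oU Ux UP; apply: filterS UP _; exact: open_nbhs_nbhs. Qed.

Lemma smooth_upto_eq n U h h' : open U -> (forall x, U x -> h x = h' x) ->
  smooth_upto n U h -> smooth_upto n U h'.
Proof.
move=> oU; elim: n h h' => [|n IH] h h' hh' [dh sh].
  split=> // x Ux.
  by apply: near_eq_differentiable (dh x Ux); exact: near_open hh'.
split=> [x Ux|k].
  by apply: near_eq_differentiable (dh x Ux); exact: near_open hh'.
by apply: IH (sh k) => x Ux; apply: near_eq_derive; exact: near_open hh'.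
Qed.

Lemma smooth_uptoD n U f h : open U ->
  smooth_upto n U f -> smooth_upto n U h -> smooth_upto n U (f + h).
Proof.
move=> oU; elim: n f h => [|n IH] f h [df sf] [dh sh].
  by split=> // x Ux; apply: differentiableD; [exact: df|exact: dh].
split=> [x Ux|k]; first by apply: differentiableD; [exact: df|exact: dh].
apply: smooth_upto_eq (IH _ _ (sf k) (sh k)) => // x Ux.
by rewrite /partial deriveD//; apply: diff_derivable; [exact: df|exact: dh].
Qed.

Lemma smooth_uptoM n U f h : open U ->
  smooth_upto n U f -> smooth_upto n U h -> smooth_upto n U (f * h).
Proof.
move=> oU; elim: n f h => [|n IH] f h sf sh.
  by split => // x Ux; apply: differentiableM;
    [exact: (smooth_upto_diff sf)|exact: (smooth_upto_diff sh)].
have [df pf] := sf; have [dh ph] := sh; split => [x Ux|k].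
  by apply: differentiableM; [exact: df|exact: dh].
apply: (@smooth_upto_eq _ _ (f * partial k h + h * partial k f)) => //.
  move=> x Ux; rewrite /partial deriveM//; apply: diff_derivable;
    [exact: df|exact: dh].
apply: smooth_uptoD => //.
  by apply: IH (ph k); exact: smooth_uptoW.
by apply: IH (pf k); exact: smooth_uptoW.
Qed.

Lemma smooth_upto_comp n U psi w : open U -> smooth_real psi ->
  smooth_upto n U w -> smooth_upto n U (psi \o w).
Proof.
move=> oU; elim: n psi w => [|n IH] psi w spsi sw.
  split=> // x Ux; apply: differentiable_comp1; first exact: (spsi 0%N).
  exact: (smooth_upto_diff sw).
have [dw pw] := sw; split => [x Ux|k].
  by apply: differentiable_comp1 (dw x Ux); exact: (spsi 0%N).
apply: (@smooth_upto_eq _ _ ((psi^`()%classic \o w) * partial k w)) => //.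
  move=> x Ux; rewrite /partial derive_comp1//; first exact: (spsi 0%N).
  exact: dw.
apply: smooth_uptoM => //; last exact: pw.
apply: IH; last exact: smooth_uptoW.
by move=> m x; have := spsi m.+1 x; rewrite derive1Sn.
Qed.

End SmoothClosure.

(** * The Hessian of a composite function *)

Section Hessian.
Context {R : realType} {d p : nat} {M : smooth_manifold R d}.
Context (metr : riemannian_metric M) (phi : smooth_form M p).
Implicit Types (f w : M -> R) (psi : R -> R) (i : chart M) (x : 'rV[R]_d).

Lemma near_img i x : img i x -> \forall y \near x, img i y.
Proof. by move=> ix; apply: open_nbhs_nbhs; split => //; exact: img_open. Qed.

Lemma smooth_fun_diff f i x :
  smooth_fun f -> img i x -> differentiable (f \o param i) x.
Proof. by move=> sf; exact: (sf i [::]). Qed.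

(** The derivative of a non-differentiable function being a default value, the
    Leibniz rule for the gradient requires its components, and therefore those
    of the inverse metric, to be differentiable. *)
Lemma differentiable_gradient f i x c : smooth_fun f -> img i x ->
  differentiable (fun y => gradient metr f i y 0 c) x.
Proof.
move=> sf ix; under eq_fun do rewrite mxE.
apply: differentiable_bigsum => k; apply: differentiableM.
  by under eq_fun do rewrite mxE; exact: (sf i [:: k]).
apply: differentiable_invmx.
  by apply: filterS (near_img ix) => y iy; exact: metric_unitmx.
by move=> a b; exact: (@metric_smooth _ _ _ metr i a b [::]).
Qed.

Lemma smooth_fun_add_comp f w psi : smooth_real psi ->
  smooth_fun f -> smooth_fun w -> smooth_fun (fun z => f z + psi (w z)).
Proof.
move=> spsi sf sw i; apply/smooth_onP => n.
have oU : open (img i) by exact: img_open.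
have -> : (fun z => f z + psi (w z)) \o param i =
  (f \o param i) + (psi \o (w \o param i)) by [].
apply: smooth_uptoD => //; first by have /smooth_onP := sf i; exact.
by apply: smooth_upto_comp => //; have /smooth_onP := sw i; exact.
Qed.

(** Functions of the form f + psi o w cover all that is needed: psi o f
    arises for f = 0 and w = f, a difference for psi(t) = -t, and the
    regularized maxima for w = g - f. *)
Lemma gradient_add_comp f w psi i x : smooth_fun f -> smooth_fun w ->
  derivable psi (w (param i x)) 1 -> img i x ->
  gradient metr (fun z => f z + psi (w z)) i x =
  gradient metr f i x + psi^`()%classic (w (param i x)) *: gradient metr w i x.
Proof.
move=> sf sw dpsi ix; rewrite /gradient scalemxAl -mulmxDl; congr (_ *m _).
have df := smooth_fun_diff sf ix; have dw := smooth_fun_diff sw ix.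
apply/rowP => k; rewrite [LHS]mxE [RHS]mxE [X in _ = X + _]mxE.
rewrite [X in _ = _ + X]mxE [X in _ = _ + _ * X]mxE /partial.
have dpw := @differentiable_comp1 _ _ psi (w \o param i) x dpsi dw.
rewrite -(@derive_comp1 _ _ psi (w \o param i) x _ dpsi dw).
by rewrite -(deriveD (diff_derivable df) (diff_derivable dpw)).
Qed.

(** The decomposition of Y is required only near x because that of a gradient
    holds only on the image of the chart. *)
Lemma levi_civita_leibniz (Y Y1 Y2 : 'rV[R]_d -> 'rV[R]_d)
    (a : 'rV[R]_d -> R) i v x :
  (\forall y \near x, Y y = Y1 y + a y *: Y2 y) ->
  (forall c, differentiable (fun y => Y1 y 0 c) x) ->
  (forall c, differentiable (fun y => Y2 y 0 c) x) ->
  differentiable a x ->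
  levi_civita metr i Y v x = levi_civita metr i Y1 v x +
    a x *: levi_civita metr i Y2 v x + 'D_v a x *: Y2 x.
Proof.
move=> YE dY1 dY2 da; apply/rowP => c.
have DY : 'D_v (fun y => Y y 0 c) x =
    'D_v (fun y => Y1 y 0 c) x +
    (a x * 'D_v (fun y => Y2 y 0 c) x + Y2 x 0 c * 'D_v a x).
  transitivity ('D_v ((fun y => Y1 y 0 c) + a * (fun y => Y2 y 0 c)) x).
    apply: near_eq_derive; apply: filterS YE => y ->.
    by rewrite [LHS]mxE; congr (_ + _); rewrite mxE.
  rewrite deriveD ?deriveM//; try exact: diff_derivable.
  by apply: derivableM; exact: diff_derivable.
have SY : \sum_k \sum_l v 0 k * Y x 0 l * christoffel metr i k l c x =
    \sum_k \sum_l v 0 k * Y1 x 0 l * christoffel metr i k l c x +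
    a x * \sum_k \sum_l v 0 k * Y2 x 0 l * christoffel metr i k l c x.
  rewrite mulr_sumr -big_split/=; apply: eq_bigr => k _.
  rewrite mulr_sumr -big_split/=; apply: eq_bigr => l _.
  rewrite (nbhs_singleton YE) [in LHS]mxE.
  by rewrite [X in _ + X]mxE; ring.
rewrite [LHS]mxE DY SY [RHS]mxE [X in _ = X + _]mxE [X in _ = _ + X]mxE.
rewrite [X in _ = X + _ + _]mxE [X in _ = _ + X + _]mxE.
by rewrite [X in _ = _ + _ * X + _]mxE; ring.
Qed.

Lemma levi_civita_add_comp f w psi i x v : smooth_real psi ->
  smooth_fun f -> smooth_fun w -> img i x ->
  levi_civita metr i (gradient metr (fun z => f z + psi (w z)) i) v x =
  levi_civita metr i (gradient metr f i) v x +
  psi^`()%classic (w (param i x)) *: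
    levi_civita metr i (gradient metr w i) v x +
  (psi^`()^`()%classic (w (param i x)) *
     (gradient metr w i x *m metr i x *m v^T) 0 0) *: gradient metr w i x.
Proof.
move=> spsi sf sw ix.
have dpsi' : derivable psi^`()%classic (w (param i x)) 1 by exact: (spsi 1%N).
have dw := smooth_fun_diff sw ix.
rewrite (@levi_civita_leibniz _ (gradient metr f i) (gradient metr w i)
  (psi^`()%classic \o (w \o param i))); last 4 first.
- apply: filterS (near_img ix) => y iy.
  exact: gradient_add_comp (spsi 0%N _) iy.
- by move=> c; exact: differentiable_gradient.
- by move=> c; exact: differentiable_gradient.
- exact: differentiable_comp1.
by rewrite gradientE// -derive_partial// -derive_comp1.
Qed.

(** Differentiating psi'(w) grad w along v gives psi'(w) times the derivative
    of grad w, plus psi''(w) dw(v) grad w, where dw(v) = <grad w, v>; the last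
    sum collects these rank one terms. *)
Lemma phi_hessian_add_comp f w psi i x v : smooth_real psi ->
  smooth_fun f -> smooth_fun w -> img i x ->
  phi_hessian metr phi (fun z => f z + psi (w z)) i x v =
  phi_hessian metr phi f i x v +
  psi^`()%classic (w (param i x)) * phi_hessian metr phi w i x v +
  psi^`()^`()%classic (w (param i x)) *
    \sum_k (gradient metr w i x *m metr i x *m (row k v)^T) 0 0 *
      phi i x (set_row k (gradient metr w i x) v).
Proof.
move=> spsi sf sw ix; rewrite /phi_hessian !mulr_sumr -!big_split/=.
have lphi : multilinear (phi i x) by exact: form_multilinear.
apply: eq_bigr => k _; rewrite levi_civita_add_comp//.
by rewrite !multilinearD// !multilinearZ// mulrA.
Qed.

Lemma phi_hessian0 i x v : img i x ->
  phi_hessian metr phi (fun=> 0) i x v = 0.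
Proof.
move=> ix; rewrite /phi_hessian big1// => k _.
have g0 y : gradient metr (fun=> 0) i y = 0.
  rewrite /gradient (_ : \row_ _ _ = 0) ?mul0mx//.
  by apply/rowP => l; rewrite !mxE /partial derive_cst.
have -> : levi_civita metr i (gradient metr (fun=> 0) i) (row k v) x = 0.
  apply/rowP => c; rewrite [LHS]mxE mxE.
  under eq_fun do rewrite g0 mxE.
  rewrite derive_cst add0r big1// => a _; rewrite big1// => b _.
  by rewrite g0 !mxE mulr0 mul0r.
by apply: multilinear0; exact: form_multilinear.
Qed.

Lemma sum_slot_gradient_ge0 w i x v : calibration metr phi -> img i x ->
  phi_plane metr phi i x v ->
  0 <= \sum_k (gradient metr w i x *m metr i x *m (row k v)^T) 0 0 *
         phi i x (set_row k (gradient metr w i x) v).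
Proof.
move=> [_ cal] ix [uv phiv]; apply: (sum_slot_ge0 _ _ _ _ _ _ uv phiv).
- exact: (Defs.metric_sym metr ix).
- exact: form_multilinear.
- exact: form_alternating.
- by move=> u; exact: cal.
- move=> y; have [->|y0] := eqVneq y 0; first by rewrite !mul0mx mxE.
  by apply: ltW; exact: (metric_pos metr ix y0).
Qed.

Lemma phi_psh_add_comp f w psi : calibration metr phi -> smooth_real psi ->
  (forall t, 0 <= psi^`()^`()%classic t) ->
  smooth_fun f -> smooth_fun w ->
  (forall i x v, img i x -> phi_plane metr phi i x v ->
    0 <= phi_hessian metr phi f i x v +
         psi^`()%classic (w (param i x)) * phi_hessian metr phi w i x v) ->
  phi_psh metr phi (fun z => f z + psi (w z)).
Proof.
move=> cal spsi psi2 sf sw H; split; first exact: smooth_fun_add_comp.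
move=> i x v ix pv; rewrite phi_hessian_add_comp// addr_ge0 ?H//.
by rewrite mulr_ge0// sum_slot_gradient_ge0.
Qed.

Lemma smooth_funcst c : smooth_fun (fun _ : M => c).
Proof.
move=> i; apply/smooth_onP => n.
elim: n c => [|n IH] c; (split; first by move=> x _; exact: differentiable_cst).
  by [].
move=> k; rewrite (_ : partial _ _ = (fun=> 0)); first exact: IH.
by apply/funext => x; rewrite /partial derive_cst.
Qed.

Lemma derive1_opp : (-%R : R -> R)^`()%classic = cst (-1).
Proof. by apply/funext => t; rewrite derive1E deriveN// derive_id. Qed.

Lemma smooth_real_cst (c : R) : smooth_real (cst c : R -> R).
Proof.
move=> k; elim: k c => [|k IH] c x; first exact: derivable_cst.
rewrite derive1Sn (_ : _^`()%classic = cst 0); first exact: IH.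
by apply/funext => t; rewrite derive1_cst.
Qed.

Lemma smooth_real_opp : smooth_real (-%R : R -> R).
Proof.
case=> [|k] x; first exact: derivable_opp.
by rewrite derive1Sn derive1_opp; exact: smooth_real_cst.
Qed.

Lemma phi_hessianB f w i x v : smooth_fun f -> smooth_fun w -> img i x ->
  phi_hessian metr phi (fun z => f z - w z) i x v =
  phi_hessian metr phi f i x v - phi_hessian metr phi w i x v.
Proof.
move=> sf sw ix; rewrite (phi_hessian_add_comp v smooth_real_opp sf sw ix).
by rewrite derive1_opp derive1_cst mul0r addr0 mulN1r.
Qed.

(** The Hessian of psi o f is psi' H(f) plus psi'' times the nonnegative rank
    one term of f. *)
Lemma phi_psh_comp f psi : calibration metr phi -> smooth_real psi ->
  (forall t, 0 <= psi^`()%classic t) ->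
  (forall t, 0 <= psi^`()^`()%classic t) ->
  phi_psh metr phi f -> phi_psh metr phi (psi \o f).
Proof.
move=> cal spsi psi1 psi2 [sf psh_f].
have -> : psi \o f = (fun z => 0 + psi (f z)).
  by apply/funext => z; rewrite add0r.
apply: phi_psh_add_comp => //; first exact: smooth_funcst.
move=> i x v ix pv; rewrite phi_hessian0// add0r mulr_ge0//; exact: psh_f.
Qed.

(** The Hessian of f + psi(g - f) is (1 - psi') H(f) + psi' H(g), a convex
    combination of nonnegative terms, plus psi'' times the nonnegative rank
    one term of g - f. *)
Lemma phi_psh_interpolate f g psi : calibration metr phi -> smooth_real psi ->
  (forall t, 0 <= psi^`()%classic t <= 1) ->
  (forall t, 0 <= psi^`()^`()%classic t) ->
  phi_psh metr phi f -> phi_psh metr phi g ->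
  phi_psh metr phi (fun z => f z + psi (g z - f z)).
Proof.
move=> cal spsi psi1 psi2 [sf psh_f] [sg psh_g].
apply: phi_psh_add_comp => //.
  exact: smooth_fun_add_comp smooth_real_opp sg sf.
move=> i x v ix pv; rewrite phi_hessianB//.
have Hf := psh_f _ _ _ ix pv; have Hg := psh_g _ _ _ ix pv.
have /andP[] := psi1 (g (param i x) - f (param i x)).
move: (phi_hessian _ _ f _ _ _) (phi_hessian _ _ g _ _ _) Hf Hg.
move: (psi^`()%classic _) => t a b a0 b0 t0 t1; nra.
Qed.

End Hessian.

(** * Functions of one variable *)

Section Convex.
Context {R : realType}.
Implicit Types psi : R -> R.

Lemma nondecreasing_derive1_ge0 psi t : derivable psi t 1 ->
  {homo psi : x y / x <= y} -> 0 <= psi^`()%classic t.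
Proof.
move=> dpsi homo_psi; rewrite derive1E.
apply: cvgr_to_ge (cvg_dnbhs_at_right dpsi) _.
near=> h; have h0 : 0 < h by near: h; exact: nbhs_right_gt.
rewrite [h%:A]mulr1 mulr_ge0 ?invr_ge0 ?(ltW h0)// subr_ge0 homo_psi//.
by rewrite lerDr ltW.
Unshelve. all: by end_near. Qed.

(** The chord slopes (psi (x + h (y - x)) - psi x) / h are at most
    psi y - psi x for h in (0, 1]; let h tend to 0. *)
Lemma convex_tangent psi x y : derivable psi x 1 ->
  convex_function [set: R^o] psi ->
  psi x + psi^`()%classic x * (y - x) <= psi y.
Proof.
move=> dpsi cpsi; have /derivable1_diffP dpsi' := dpsi.
have -> : psi^`()%classic x * (y - x) = 'D_(y - x) psi x.
  by rewrite deriveE// deriv1E// [RHS]mulrC.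
have dt : derivable psi x (y - x) by exact: diff_derivable.
rewrite -lerBrDl; apply: cvgr_to_le (cvg_dnbhs_at_right dt) _.
near=> h; have h0 : 0 < h by near: h; exact: nbhs_right_gt.
have h1 : h <= 1 by near: h; exact: nbhs_right_le.
have := cpsi (Itv01 (ltW h0) h1) y x (in_setT _) (in_setT _).
rewrite !convRE/= [X in psi X](_ : _ = h *: (y - x) + x); last first.
  rewrite /conv/= /GRing.scale/= /unstable.onem; ring.
move=> le_psi; rewrite /GRing.scale/= ler_pdivrMl//.
by move: le_psi; rewrite /unstable.onem /GRing.scale/=; lra.
Unshelve. all: by end_near. Qed.

(** Adding the tangent inequalities at x and at y shows that psi' is
    nondecreasing. *)
Lemma convex_derive2_ge0 psi t : smooth_real psi ->
  convex_function [set: R^o] psi -> 0 <= psi^`()^`()%classic t.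
Proof.
move=> spsi cpsi; apply: nondecreasing_derive1_ge0; first exact: (spsi 1%N).
move=> x y; rewrite le_eqVlt => /predU1P[->//|xy].
have := convex_tangent y (spsi 0%N x) cpsi.
have := convex_tangent x (spsi 0%N y) cpsi.
rewrite /derive1n/=.
move: (psi x) (psi y) (psi^`()%classic x) (psi^`()%classic y) => a b a' b'.
by move=> ? ?; rewrite -(ler_pM2r (_ : 0 < y - x)) ?subr_gt0//; lra.
Qed.

End Convex.

Section Softplus.
Context {R : realType}.
Implicit Types c t : R.

(** c^-1 log (e^(c a) + e^(c b)) = a + softplus c (b - a), which reduces a
    function of two variables to one of a single variable. *)
Definition softplus c t := c^-1 * ln (1 + expR (c * t)).

(** For c <> 0 the derivative of softplus c is 1 - fermi c. As fermi c solves the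
    autonomous equation y' = c (y^2 - y), all derivatives of softplus c are
    polynomials in fermi c. *)
Definition fermi c t := (1 + expR (c * t))^-1.

Lemma onep_expR_gt0 (s : R) : 0 < 1 + expR s.
Proof. by rewrite addr_gt0// expR_gt0. Qed.

Lemma is_derive_onep_expR c t :
  is_derive t 1 (fun t => 1 + expR (c * t)) (c * expR (c * t)).
Proof.
have dc : is_derive t 1 (fun t : R => c * t) c.
  by have := is_deriveZ c (is_derive_id t 1); rewrite [c *: 1]mulr1.
have de : is_derive t 1 (fun t : R => expR (c * t)) (c * expR (c * t)).
  have := is_derive1_comp (is_derive_expR (c * t)) dc.
  by rewrite [X in is_derive _ _ _ X]mulrC.
have dk : is_derive t 1 (cst 1 : R -> R) 0 by exact: is_derive_cst.
by have := is_deriveD dk de; rewrite add0r.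
Qed.

Lemma is_derive_softplus c t : c != 0 ->
  is_derive t 1 (softplus c) (1 - fermi c t).
Proof.
move=> c0; have dl := @is_derive1_comp _ _ (fun s : R => 1 + expR (c * s)) _ _ _
  (is_derive1_ln (onep_expR_gt0 (c * t))) (is_derive_onep_expR c t).
have ds : is_derive t 1 (softplus c) _ := is_deriveZ c^-1 dl.
apply: (is_derive_eq ds).
rewrite /fermi /GRing.scale/=; field.
by rewrite c0 gt_eqF// onep_expR_gt0.
Qed.

Lemma is_derive_fermi c t :
  is_derive t 1 (fermi c) (c * (fermi c t ^+ 2 - fermi c t)).
Proof.
have dl := is_derive_onep_expR c t.
have n0 : 1 + expR (c * t) != 0 by rewrite gt_eqF// onep_expR_gt0.
have ds : is_derive t 1 (fermi c) _ :=
  @is_deriveV _ (fun s : R => 1 + expR (c * s)) _ _ _ n0 dl.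
apply: (is_derive_eq ds).
by rewrite /fermi /GRing.scale/=; field.
Qed.

Lemma fermi_itv c t : 0 <= fermi c t <= 1.
Proof.
rewrite invr_ge0 ltW ?onep_expR_gt0//=.
by rewrite invf_le1 ?onep_expR_gt0// lerDl expR_ge0.
Qed.

Lemma is_derive_horner_fermi c (q : {poly R}) t :
  is_derive t 1 (fun s => q.[fermi c s])
    (c *: (q^`() * ('X^2 - 'X))).[fermi c t].
Proof.
have dq : is_derive t 1 (fun s => q.[fermi c s]) _ :=
  @is_derive1_comp _ _ (fermi c) _ _ _
  (is_derive_poly q (fermi c t)) (is_derive_fermi c t).
apply: (is_derive_eq dq).
by rewrite hornerZ hornerM hornerD hornerN hornerXn hornerX; ring.
Qed.

Lemma derive1_softplus c : c != 0 ->
  (softplus c)^`()%classic = (fun t => (1 - 'X).[fermi c t]).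
Proof.
move=> c0; apply/funext => t; have [_] := is_derive_softplus t c0.
by rewrite derive1E => ->; rewrite !hornerE.
Qed.

Lemma derive1_horner_fermi c (q : {poly R}) :
  (fun s => q.[fermi c s])^`()%classic =
  (fun s => (c *: (q^`() * ('X^2 - 'X))).[fermi c s]).
Proof.
apply/funext => t; rewrite derive1E.
by have [_] := is_derive_horner_fermi c q t.
Qed.

Lemma smooth_softplus c : c != 0 -> smooth_real (softplus c).
Proof.
move=> c0 [|k] t; first by have [] := is_derive_softplus t c0.
rewrite derive1Sn derive1_softplus//.
elim: k (1 - 'X) t => [|k IH] q t.
  by have [] := is_derive_horner_fermi c q t.
by rewrite derive1Sn derive1_horner_fermi; exact: IH.
Qed.

Lemma derive1_softplus_itv c t : c != 0 ->
  0 <= (softplus c)^`()%classic t <= 1.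
Proof.
by move=> c0; have := fermi_itv c t; rewrite derive1_softplus// !hornerE; lra.
Qed.

Lemma derive2_softplus_ge0 c t : 0 < c ->
  0 <= (softplus c)^`()^`()%classic t.
Proof.
move=> c0; rewrite derive1_softplus ?gt_eqF// derive1_horner_fermi.
have -> : (1 - 'X : {poly R})^`() = - 1%:P.
  by rewrite derivB derivX -polyC1 derivC sub0r.
rewrite hornerZ hornerM hornerD !hornerN hornerC hornerXn hornerX.
have /andP[f0 f1] := fermi_itv c t.
by rewrite mulr_ge0 ?(ltW c0)//; nra.
Qed.

Lemma softplus_ge0 c t : 0 < c -> 0 <= softplus c t.
Proof.
by move=> c0; rewrite mulr_ge0 ?invr_ge0 ?(ltW c0)// ln_ge0// lerDl expR_ge0.
Qed.

Lemma softplus_le c c' t : 0 < c -> c <= c' -> t <= 0 ->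
  softplus c' t <= softplus c t.
Proof.
move=> c0 cc' t0; have c'0 := lt_le_trans c0 cc'.
rewrite ler_pM ?invr_ge0 ?(ltW c'0) ?ln_ge0 ?lerDl ?expR_ge0//.
  by rewrite lef_pV2 ?posrE.
by rewrite ler_ln ?posrE ?onep_expR_gt0// lerD2l ler_expR ler_wnM2r.
Qed.

Lemma softplus_le_ln2 c t : 0 < c -> t <= 0 -> softplus c t <= c^-1 * ln 2.
Proof.
move=> c0 t0; rewrite ler_pM2l ?invr_gt0// ler_ln ?posrE ?onep_expR_gt0//.
by rewrite -[2]/(1 + 1) lerD2l -expR0 ler_expR mulr_ge0_le0 ?(ltW c0).
Qed.

Lemma log_sum_exp c (a b : R) : c != 0 ->
  c^-1 * ln (expR (c * a) + expR (c * b)) = a + softplus c (b - a).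
Proof.
move=> c0; have -> : expR (c * a) + expR (c * b) =
    expR (c * a) * (1 + expR (c * (b - a))).
  by rewrite mulrDr mulr1 -expRD; congr (_ + expR _); ring.
rewrite lnM ?posrE ?expR_gt0 ?onep_expR_gt0// expRK mulrDr mulKf//.
Qed.

(** Factoring out the larger exponential leaves an error term that, for c > 0,
    decreases with c and lies between 0 and c^-1 ln 2. *)
Lemma log_sum_exp_max c (a b : R) : c != 0 ->
  c^-1 * ln (expR (c * a) + expR (c * b)) =
  Num.max a b + softplus c (- `|b - a|).
Proof.
move=> c0; have [ab|ba] := leP a b.
  by rewrite ger0_norm ?subr_ge0// opprB addrC log_sum_exp.
by rewrite ltr0_norm ?subr_lt0// opprK log_sum_exp.
Qed.

End Softplus.

(** * Regularized maxima of plurisubharmonic functions *)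

Theorem proposition1p5 (R : realType) (d p : nat) (X : smooth_manifold R d)
    (metr : riemannian_metric X) (phi : smooth_form X p)
    (p_gt0 : (1 <= p)%N) (phi_cal : calibration metr phi)
    (f g : X -> R) (f_psh : phi_psh metr phi f) (g_psh : phi_psh metr phi g) :
  let h (n : nat) (x : X) : R :=
    n%:R^-1 * ln (expR (n%:R * f x) + expR (n%:R * g x)) in
  [/\ forall psi : R -> R, smooth_real psi -> convex_function [set: R^o] psi ->
        {homo psi : s t / s <= t} -> phi_psh metr phi (psi \o f),
      phi_psh metr phi (fun x => ln (expR (f x) + expR (g x))) &
      [/\ forall n : nat, (1 <= n)%N -> phi_psh metr phi (h n),
          forall (n : nat) (x : X), (1 <= n)%N -> h n.+1 x <= h n x &
          forall (n : nat) (x : X), (1 <= n)%N ->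
            h n x - n%:R^-1 * ln 2 <= Num.max (f x) (g x) <= h n x]].
Proof.
move=> h.
have hE n x : (1 <= n)%N -> h n x = f x + softplus n%:R (g x - f x).
  by move=> n1; rewrite /h log_sum_exp// pnatr_eq0 -lt0n.
have hE_max n x : (1 <= n)%N ->
    h n x = Num.max (f x) (g x) + softplus n%:R (- `|g x - f x|).
  by move=> n1; rewrite /h log_sum_exp_max// pnatr_eq0 -lt0n.
have h_psh n : (1 <= n)%N -> phi_psh metr phi (h n).
  move=> n1; have n0 : 0 < n%:R :> R by rewrite ltr0n.
  have -> : h n = (fun x => f x + softplus n%:R (g x - f x)).
    by apply/funext => x; exact: hE.
  apply: phi_psh_interpolate => //.
  - by apply: smooth_softplus; rewrite gt_eqF.
  - by move=> t; apply: derive1_softplus_itv; rewrite gt_eqF.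
  - by move=> t; exact: derive2_softplus_ge0.
split.
- move=> psi spsi cpsi homo_psi; apply: phi_psh_comp => //.
  + by move=> t; apply: nondecreasing_derive1_ge0; first exact: (spsi 0%N).
  + by move=> t; exact: convex_derive2_ge0.
- have -> : (fun x => ln (expR (f x) + expR (g x))) = h 1%N.
    by apply/funext => x; rewrite /h invr1 !mul1r.
  exact: h_psh.
- split=> [//|n x n1|n x n1].
    rewrite !hE_max// lerD2l softplus_le ?oppr_le0 ?normr_ge0//.
      by rewrite ltr0n.
    by rewrite ler_nat.
  have n0 : 0 < n%:R :> R by rewrite ltr0n.
  have d0 : - `|g x - f x| <= 0 by rewrite oppr_le0 normr_ge0.
  rewrite hE_max// lerBlDr lerD2l lerDl softplus_ge0// andbT.
  exact: softplus_le_ln2.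
Qed.
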